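(* Let $R$ be a unital ring with involution and let $a\in R$. Then the following are equivalent: (1) $a$ is an EP element; (2) there exists $x\in R$ such that $axa=a$, $xR=aR$ and $Rx^*=Ra$; (3) there exists $x\in R$ such that $axa=a$, $xR=aR$ and $Rx^*\subseteq Ra$; (4) there exists $x\in R$ such that $xax=x$, $xR=aR$ and $Rx^*=Ra$; (5) there exists $x\in R$ such that $xax=x$, $xR=aR$ and $Ra\subseteq Rx^*$; (6) there exists $x\in R$ such that $axa=a$, ${}^{\circ}x={}^{\circ}a$ and $(x^* )^{\circ}=a^{\circ}$; (7) there exists $x\in R$ such that $axa=a$, ${}^{\circ}x={}^{\circ}a$ and $a^{\circ}\subseteq (x^* )^{\circ}$; (8) there exists $x\in R$ such that $xax=x$, ${}^{\circ}x={}^{\circ}a$ and $(x^* )^{\circ}=a^{\circ}$; (9) there exists $x\in R$ such that $xax=x$, ${}^{\circ}x={}^{\circ}a$ and $(x^* )^{\circ}\subseteq a^{\circ}$.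
   Context: A unital (associative, not necessarily commutative) ring with involution is a unital ring $R$ with a map $a\mapsto a^*$ satisfying $(a^* )^*=a$, $(ab)^*=b^*a^*$, $(a+b)^*=a^*+b^*$ for all $a,b\in R$. The Moore-Penrose inverse of $a\in R$ is the element $a^\dagger=x$ (unique if it exists) with $axa=a$, $xax=x$, $(ax)^*=ax$, $(xa)^*=xa$; the group inverse of $a$ is the element $a^\#=x$ (unique if it exists) with $axa=a$, $xax=x$, $ax=xa$. An element $a\in R$ is EP if it is both Moore-Penrose invertible and group invertible and $a^\dagger=a^\#$. Notation: $aR=\{ax:x\in R\}$, $Ra=\{xa:x\in R\}$, ${}^{\circ}a=\{x\in R:xa=0\}$, $a^{\circ}=\{x\in R:ax=0\}$. *)

(* Defs.v *)
From mathcomp Require Import all_boot all_algebra.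
From mathcomp Require Import classical_sets.

Set Implicit Arguments.
Unset Strict Implicit.
Unset Printing Implicit Defensive.

Import GRing.Theory.
Local Open Scope classical_set_scope.
Local Open Scope ring_scope.

(* Rings are taken in [pzRingType], i.e. not necessarily commutative, with unit,
   and with the zero ring allowed. *)

Record ring_involution (R : pzRingType) (star : R -> R) : Prop := RingInvolution {
  starK : forall a, star (star a) = a;
  starM : forall a b, star (a * b) = star b * star a;
  starD : forall a b, star (a + b) = star a + star b
}.

Definition MP_inverse (R : pzRingType) (star : R -> R) (a x : R) : Prop :=
  [/\ a * x * a = a, x * a * x = x,
      star (a * x) = a * x & star (x * a) = x * a].

Definition group_inverse (R : pzRingType) (a x : R) : Prop :=
  [/\ a * x * a = a, x * a * x = x & a * x = x * a].

Definition MP_invertible (R : pzRingType) (star : R -> R) (a : R) : Prop :=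
  exists x, MP_inverse star a x.

Definition group_invertible (R : pzRingType) (a : R) : Prop :=
  exists x, group_inverse a x.

Lemma MP_inverse_unique (R : pzRingType) (star : R -> R) (a x y : R) :
  ring_involution star -> MP_inverse star a x -> MP_inverse star a y -> x = y.
Proof.
move=> inv [axa xax ax xa] [aya yay ay ya].
have exy : a * x = a * y.
  have e : a * x = a * y * (a * x) by rewrite mulrA aya.
  by rewrite -ax e (starM inv) ax ay mulrA axa.
have eyx : x * a = y * a.
  have e : x * a = x * a * (y * a) by rewrite -!mulrA (mulrA a) aya.
  by rewrite -xa e (starM inv) xa ya -!mulrA (mulrA a) axa.
by rewrite -xax eyx -mulrA exy mulrA yay.
Qed.

Lemma group_inverse_unique (R : pzRingType) (a x y : R) :
  group_inverse a x -> group_inverse a y -> x = y.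
Proof.
move=> [axa xax xC] [aya yay yC].
have exy : a * x = a * y.
  have e : a * x = a * y * (a * x) by rewrite mulrA aya.
  by rewrite e yC xC -mulrA (mulrA a) axa.
by rewrite -xax -xC exy yC -mulrA exy mulrA yay.
Qed.

(* In the last clause [x] and [y] are the unique inverses above, so that it
   says that the Moore-Penrose and the group inverse of [a] coincide. *)
Definition EP (R : pzRingType) (star : R -> R) (a : R) : Prop :=
  [/\ MP_invertible star a, group_invertible a &
      forall x y, MP_inverse star a x -> group_inverse a y -> x = y].

(* aR *)
Definition right_ideal (R : pzRingType) (a : R) : set R :=
  [set a * x | x in [set: R]].

(* Ra *)
Definition left_ideal (R : pzRingType) (a : R) : set R :=
  [set x * a | x in [set: R]].

Definition left_annihilator (R : pzRingType) (a : R) : set R :=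
  [set x | x * a = 0].

Definition right_annihilator (R : pzRingType) (a : R) : set R :=
  [set x | a * x = 0].

(* Main.v *)
Require Import Defs.
From mathcomp Require Import all_boot all_algebra.
From mathcomp Require Import classical_sets.

(** An EP element [a] is one that is invertible in the corner ring [p R p] of a
self-adjoint idempotent [p]; its inverse [x] there is at once the Moore-Penrose
and the group inverse, with [a * x = x * a = p].  Such an [x] satisfies all the
existential conditions of the theorem ([EP_witness]).

Conversely, inclusions of principal ideals reverse to inclusions of
annihilators.  So, among the conditions with [a * x * a = a], the weakest is the
one with [right_annihilator a `<=` right_annihilator (star x)], and among those
with [x * a * x = x] the one with the opposite inclusion.  In the first case the
projection is recovered as [p = x * a]: applied to [1 - a * x] and [1 - x * a],
which kill [a] on the left and on the right, the annihilator hypotheses become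
identities.  The second yields [star p * p = p], so that [p] is self-adjoint and
fixes [x] on the left, hence also [a]; the first yields a right inverse of [a]
relative to [p], of which [x] is a left inverse ([inner_annihilators_EP]).  In
the second case the same device shows that [x] is also an inner inverse of
[a], which leads back to the first case ([outer_annihilators_EP]). *)

Local Open Scope classical_set_scope.
Local Open Scope ring_scope.

Import GRing.Theory.

Section Ideals.
Set Implicit Arguments.
Variable R : pzRingType.
Implicit Types a b c : R.

Lemma right_ideal_sub a b c : b = a * c -> right_ideal b `<=` right_ideal a.
Proof. by move=> -> _ [y _ <-]; exists (c * y); rewrite ?mulrA. Qed.

Lemma left_ideal_sub a b c : b = c * a -> left_ideal b `<=` left_ideal a.
Proof. by move=> -> _ [y _ <-]; exists (y * c); rewrite ?mulrA. Qed.

Lemma left_annihilator_sub a b :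
  right_ideal b `<=` right_ideal a ->
  left_annihilator a `<=` left_annihilator b.
Proof.
move=> ba y ya; have [|c _ <-] := ba b; first by exists 1; rewrite ?mulr1.
by rewrite /left_annihilator /= mulrA ya mul0r.
Qed.

Lemma right_annihilator_sub a b :
  left_ideal b `<=` left_ideal a ->
  right_annihilator a `<=` right_annihilator b.
Proof.
move=> ba y ay; have [|c _ <-] := ba b; first by exists 1; rewrite ?mul1r.
by rewrite /right_annihilator /= -mulrA ay mulr0.
Qed.

Lemma left_annihilator_eq a b :
  right_ideal a = right_ideal b -> left_annihilator a = left_annihilator b.
Proof.
by move=> ab; apply/seteqP; split; apply: left_annihilator_sub; rewrite ab.
Qed.

Lemma right_annihilator_eq a b :
  left_ideal a = left_ideal b -> right_annihilator a = right_annihilator b.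
Proof.
by move=> ab; apply/seteqP; split; apply: right_annihilator_sub; rewrite ab.
Qed.

(** The form in which annihilator inclusions are used: they transport identities
[e * a = a], since these say that [1 - e] annihilates [a]. *)
Lemma left_annihilator_fix a b e :
  left_annihilator a `<=` left_annihilator b -> e * a = a -> e * b = b.
Proof.
move=> ab ea; have /eqP : (1 - e) * b = 0.
  by apply: ab; rewrite /left_annihilator /= mulrBl mul1r ea subrr.
by rewrite mulrBl mul1r subr_eq0 => /eqP.
Qed.

Lemma right_annihilator_fix a b e :
  right_annihilator a `<=` right_annihilator b -> a * e = a -> b * e = b.
Proof.
move=> ab ae; have /eqP : b * (1 - e) = 0.
  by apply: ab; rewrite /right_annihilator /= mulrBr mulr1 ae subrr.
by rewrite mulrBr mulr1 subr_eq0 => /eqP.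
Qed.

End Ideals.

Section EPElements.
Set Implicit Arguments.
Variables (R : pzRingType) (star : R -> R).
Hypothesis star_inv : ring_involution star.
Implicit Types a p x t : R.

Lemma self_adjoint_of_star_mul p : star p * p = p -> star p = p.
Proof. by move=> e; rewrite -[in LHS]e (starM star_inv) (starK star_inv). Qed.

Lemma EP_of_common_inverse a x :
  MP_inverse star a x -> group_inverse a x -> EP star a.
Proof.
move=> ax_MP ax_group; split; [by exists x | by exists x |] => y z ay az.
rewrite (MP_inverse_unique star_inv ay ax_MP).
exact: group_inverse_unique ax_group az.
Qed.

(** Here [a] lies in the corner ring of [p], and [x], [t] become a left and a
right inverse of [a] there once they are compressed to the corner, and a left
and a right inverse agree. *)
Lemma EP_of_corner_inverses a p x t :
  star p = p -> p * a = a -> a * p = a -> x * a = p -> a * t = p -> EP star a.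
Proof.
move=> p_sa pa ap xa at_p.
have pp : p * p = p by rewrite -{2}at_p mulrA pa.
pose y := p * x * p.
have ya : y * a = p by rewrite /y -!mulrA pa xa pp.
have yp : y * p = y by rewrite /y -[LHS]mulrA pp.
have ay : a * y = p by rewrite -yp -{1}at_p (mulrA y) ya mulrA ap.
have py : p * y = y by rewrite /y !mulrA pp.
by apply: (@EP_of_common_inverse a y); split; rewrite ?ay ?ya.
Qed.

Lemma EP_witness a : EP star a ->
  exists x, [/\ a * x * a = a, x * a * x = x,
                right_ideal x = right_ideal a
              & left_ideal (star x) = left_ideal a].
Proof.
move=> [[x ax_MP] [y ay_group] xy].
have eq_xy := xy _ _ ax_MP ay_group; rewrite -eq_xy in ay_group.
have [axa xax _ xa_sa] := ax_MP; have [_ _ ax_xa] := ay_group.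
exists x; split=> //; apply/seteqP; split.
- by apply: (@right_ideal_sub _ _ _ (x * x)); rewrite mulrA ax_xa xax.
- by apply: (@right_ideal_sub _ _ _ (a * a)); rewrite mulrA -ax_xa axa.
- apply: (@left_ideal_sub _ _ _ (star x * x)).
  by rewrite -mulrA -xa_sa -(starM star_inv) xax.
- apply: (@left_ideal_sub _ _ _ (a * star a)).
  by rewrite -mulrA -(starM star_inv) xa_sa mulrA axa.
Qed.

(** The right inverse of [a] relative to [x * a] is [x * x * a], because
[a * x] fixes [x]. *)
Lemma inner_annihilators_EP a x :
  a * x * a = a -> left_annihilator x = left_annihilator a ->
  right_annihilator a `<=` right_annihilator (star x) -> EP star a.
Proof.
move=> axa lxa rax.
have axx : a * x * x = x by apply: left_annihilator_fix axa; rewrite lxa.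
have sxxa : star x * (x * a) = star x.
  by apply: right_annihilator_fix rax _; rewrite mulrA.
have sxa_x : star (x * a) * x = x.
  by have := congr1 star sxxa; rewrite (starM star_inv) (starK star_inv).
have xa_sa : star (x * a) = x * a.
  by apply: self_adjoint_of_star_mul; rewrite mulrA sxa_x.
rewrite xa_sa in sxa_x.
have xaa : x * a * a = a by apply: left_annihilator_fix sxa_x; rewrite lxa.
apply: (@EP_of_corner_inverses a (x * a) x (x * x * a)) => //.
  by rewrite mulrA.
by rewrite !mulrA axx.
Qed.

(** Since [star (x * a)] fixes [star x] on the right, it fixes [a] too; hence
[x * a] is self-adjoint, and then the same identity reads [a * x * a = a]. *)
Lemma outer_annihilators_EP a x :
  x * a * x = x -> left_annihilator x = left_annihilator a ->
  right_annihilator (star x) `<=` right_annihilator a -> EP star a.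
Proof.
move=> xax lxa rxa.
have a_sxa : a * star (x * a) = a.
  by apply: right_annihilator_fix rxa _; rewrite -(starM star_inv) xax.
have xa_sa : star (x * a) = x * a.
  have e : x * a * star (x * a) = x * a by rewrite -mulrA a_sxa.
  by rewrite -[in LHS]e (starM star_inv) (starK star_inv).
have axa : a * x * a = a by rewrite -mulrA -xa_sa.
apply: (inner_annihilators_EP axa lxa) => y ay.
(* [star x] is a left multiple of [a]. *)
rewrite /right_annihilator /= -[in star x]xax (starM star_inv) xa_sa.
by rewrite -!mulrA ay !mulr0.
Qed.

End EPElements.

Theorem theorem2p5 (R : pzRingType) (star : R -> R)
    (star_inv : ring_involution star) (a : R) :
  [<-> EP star a;
       exists x : R, [/\ a * x * a = a, right_ideal x = right_ideal a
                       & left_ideal (star x) = left_ideal a];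
       exists x : R, [/\ a * x * a = a, right_ideal x = right_ideal a
                       & left_ideal (star x) `<=` left_ideal a];
       exists x : R, [/\ x * a * x = x, right_ideal x = right_ideal a
                       & left_ideal (star x) = left_ideal a];
       exists x : R, [/\ x * a * x = x, right_ideal x = right_ideal a
                       & left_ideal a `<=` left_ideal (star x)];
       exists x : R, [/\ a * x * a = a,
                         left_annihilator x = left_annihilator a
                       & right_annihilator (star x) = right_annihilator a];
       exists x : R, [/\ a * x * a = a,
                         left_annihilator x = left_annihilator a
                       & right_annihilator a `<=` right_annihilator (star x)];
       exists x : R, [/\ x * a * x = x,
                         left_annihilator x = left_annihilator a
                       & right_annihilator (star x) = right_annihilator a];
       exists x : R, [/\ x * a * x = x,
                         left_annihilator x = left_annihilator a
                       & right_annihilator (star x) `<=` right_annihilator a]].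
Proof.
tfae.
- by move=> /(EP_witness star_inv)[x [axa _ xR Rx]]; exists x.
- by move=> [x [axa xR Rx]]; exists x; split=> //; rewrite Rx.
- move=> [x [axa /left_annihilator_eq lx /right_annihilator_sub rx]].
  have /(EP_witness star_inv)[y [_ yay yR Ry]] :=
    inner_annihilators_EP star_inv axa lx rx.
  by exists y.
- by move=> [x [xax xR Rx]]; exists x; split=> //; rewrite Rx.
- move=> [x [xax /left_annihilator_eq lx /right_annihilator_sub rx]].
  have /(EP_witness star_inv)[y [aya _ yR Ry]] :=
    outer_annihilators_EP star_inv xax lx rx.
  exists y; split=> //; first exact: left_annihilator_eq.
  exact: right_annihilator_eq.
- by move=> [x [axa lx rx]]; exists x; split=> //; rewrite rx.
- move=> [x [axa lx rx]].
  have /(EP_witness star_inv)[y [_ yay yR Ry]] :=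
    inner_annihilators_EP star_inv axa lx rx.
  exists y; split=> //; first exact: left_annihilator_eq.
  exact: right_annihilator_eq.
- by move=> [x [xax lx rx]]; exists x; split=> //; rewrite rx.
- by move=> [x [xax lx rx]]; exact: outer_annihilators_EP xax lx rx.
Qed.
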